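(* Let $H$ be a complex Hilbert space with $\dim H \geq 2$, and let $\mathcal{A}$ be a unital standard operator algebra on $H$ such that $\mathcal{A}$ is closed under the adjoint operation. Suppose that $\varphi : \mathcal{A} \to \mathcal{A}$ is a linear map. Then the following conditions are equivalent: (i) $\varphi$ is a left centralizer, i.e. $\varphi(AB) = \varphi(A)B$ for all $A, B \in \mathcal{A}$; (ii) for all $A, B \in \mathcal{A}$, if $AB^\star = 0$ then $A\,\varphi(B)^\star = 0$.
   Context: All algebras and vector spaces are over the complex field $\mathbb{C}$. For a Hilbert space $H$, $B(H)$ denotes the algebra of all bounded linear operators on $H$, $F(H)$ the algebra of all finite rank operators in $B(H)$, $I$ the identity operator, and $A^\star$ the Hilbert space adjoint of $A \in B(H)$. A standard operator algebra on $H$ is any subalgebra of $B(H)$ which contains $F(H)$ (it need not be norm closed); unital means that it contains $I$. A linear map $\varphi : \mathcal{A} \to \mathcal{A}$ is a left centralizer if $\varphi(AB) = \varphi(A)B$ for all $A, B \in \mathcal{A}$. No continuity of $\varphi$ is assumed. *)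

(* Defs.v *)
From HB Require Import structures.
From mathcomp Require Import all_boot all_order all_algebra.
From mathcomp Require Import complex.
From mathcomp Require Import boolp classical_sets functions reals.
From mathcomp Require Import topology normedtype.

Set Implicit Arguments.
Unset Strict Implicit.
Unset Printing Implicit Defensive.

Import Order.TTheory GRing.Theory Num.Theory.
Import numFieldNormedType.Exports.

Local Open Scope classical_set_scope.
Local Open Scope ring_scope.
Local Open Scope complex_scope.

(* The inner product is linear in its first argument and conjugate-linear in
   its second one. The norm takes its (real, nonnegative) values in R[i]. *)
HB.mixin Record isHilbert (R : realType) (H : Type)
    of CompleteNormedModule R[i] H := {
  inner : {dot H for Num.conj} ;
  sqr_normE : forall x : H, `|x| ^+ 2 = inner x x
}.

#[short(type="hilbertType")]
HB.structure Definition Hilbert (R : realType) :=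
  {H of isHilbert R H & CompleteNormedModule R[i] H}.

Section operators.
Variables (R : realType) (H : hilbertType R).
Implicit Types (S T : H -> H) (A : set (H -> H)) (phi : (H -> H) -> (H -> H)).

Definition dim_ge (n : nat) : Prop :=
  exists v : 'I_n -> H, forall c : 'I_n -> R[i],
    \sum_(i < n) c i *: v i = 0 -> forall i, c i = 0.

Definition bounded_operators : set (H -> H) :=
  [set T | linear T /\ exists M : R[i], forall x, `|T x| <= M * `|x|].

Definition finite_rank_operators : set (H -> H) :=
  [set T | bounded_operators T /\
    exists n (v : 'I_n -> H), forall x, exists c : 'I_n -> R[i],
      T x = \sum_(i < n) c i *: v i].

(* By completeness of H and the Riesz representation theorem, for T bounded
   there is exactly one such z for each y, so the default value 0 of xget is
   never used. *)
Definition adjoint T : H -> H := fun y =>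
  xget 0 [set z | forall x, inner (T x) y = inner x z].

Definition standard_operator_algebra A : Prop :=
  [/\ A `<=` bounded_operators,
      forall (a : R[i]) S T, A S -> A T -> A (a *: S + T),
      forall S T, A S -> A T -> A (S \o T)
    & finite_rank_operators `<=` A].

Definition unital A : Prop := A idfun.

Definition adjoint_closed A : Prop := forall T, A T -> A (adjoint T).

(* A map A -> A is represented by a map on all functions H -> H stable on A;
   its values outside A are irrelevant. *)
Definition linear_on A phi : Prop :=
  forall (a : R[i]) S T, A S -> A T -> phi (a *: S + T) = a *: phi S + phi T.

Definition left_centralizer A phi : Prop :=
  forall S T, A S -> A T -> phi (S \o T) = phi S \o T.

End operators.

(* Main.v *)
(** If [phi] is a left centralizer then [phi T = phi I \o T], so that
    [S (phi T)^* = S T^* (phi I)^*]. Conversely, testing (ii) on the rank-one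
    operator [S u = <u, x> x] shows that [T x = 0] implies [phi T x = 0]; by
    linearity [T x = a S x] then implies [phi T x = a (phi S x)]. Given
    [v := T x != 0], choose [w] with [<x, w>] and [<v, w>] both nonzero and set
    [F u := <u, w> v]. Then [F v = <v, w> I v], [F x = <x, w> T x] and [F] kills
    [<v, w> x - <x, w> v], whence [phi T x = phi I v = phi I (T x)]. *)

Require Import Defs.
From mathcomp Require Import all_boot all_order all_algebra.
From mathcomp Require Import complex.
From mathcomp Require Import boolp classical_sets functions reals.
From mathcomp Require Import topology normedtype.
From mathcomp Require Import ring.

Set Implicit Arguments.
Unset Strict Implicit.
Unset Printing Implicit Defensive.

Local Open Scope classical_set_scope.
Local Open Scope ring_scope.

Import Order.TTheory GRing.Theory Num.Theory.
Import numFieldNormedType.Exports.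

Section rank_one_and_adjoint.
Local Open Scope complex_scope.
Variables (R : realType) (H : hilbertType R).
Implicit Types (u v w x y z : H) (S T : H -> H) (a : R[i]).

Lemma innerDl x y z : inner (x + y) z = inner x z + inner y z.
Proof. exact: linearDl. Qed.
Lemma innerZl a x y : inner (a *: x) y = a * inner x y.
Proof. exact: linearZl_LR. Qed.
Lemma innerDr x y z : inner x (y + z) = inner x y + inner x z.
Proof. exact: linearDr. Qed.
Lemma innerBl x y z : inner (x - y) z = inner x z - inner y z.
Proof. exact: linearBl. Qed.
Lemma innerBr x y z : inner x (y - z) = inner x y - inner x z.
Proof. exact: linearBr. Qed.
Lemma innerZr a x y : inner x (a *: y) = Num.conj a * inner x y.
Proof. exact: linearZr_LR. Qed.
Lemma innerC x y : inner x y = Num.conj (inner y x).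
Proof. by rewrite {1}hermC expr0 mul1r. Qed.
Lemma inner0l x : inner 0 x = 0. Proof. exact: linear0l. Qed.
Lemma inner0r x : inner x 0 = 0. Proof. exact: linear0r. Qed.
Lemma inner_eq0 x : (inner x x == 0) = (x == 0).
Proof. by rewrite -sqr_normE expf_eq0 normr_eq0. Qed.

Lemma inner_extr y z : (forall x, inner x y = inner x z) -> y = z.
Proof.
move=> e; apply/eqP; rewrite -subr_eq0 -inner_eq0 innerBr.
by rewrite e subrr.
Qed.

(** The inner product separates vectors, so [xget] has at most one candidate. *)
Lemma adjointE T y z : (forall x, inner (T x) y = inner x z) -> adjoint T y = z.
Proof.
move=> ez; apply: inner_extr => x; rewrite -ez.
pose P := [set z' | forall x, inner (T x) y = inner x z'].
by have /(_ x) <- := @xgetPex _ 0 P (ex_intro _ z ez).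
Qed.

(** With [W = |w|^2] and [c = <u, w>], expanding [|W u - c w|^2 >= 0] gives
    [W (|u|^2 W - |c|^2) >= 0] without division. This makes rank-one operators bounded. *)
Lemma cauchy_schwarz u w : `|inner u w| <= `|u| * `|w|.
Proof.
have [->|w0] := eqVneq w 0; first by rewrite inner0r !normr0 mulr0.
have nw0 : 0 < `|w| ^+ 2 by rewrite exprn_gt0 // normr_gt0.
rewrite -(ler_pXn2r (ltn0Sn 1)) ?nnegrE ?mulr_ge0 // exprMn.
set c := inner u w.
have := exprn_ge0 2 (normr_ge0 (`|w| ^+ 2 *: u - c *: w)).
rewrite sqr_normE innerBl !innerBr !innerZl !innerZr.
rewrite (innerC w u) -/c -!sqr_normE rmorphXn /= (conj_Creal (normr_real w)).
rewrite normCK; set W := `|w| ^+ 2; set U := `|u| ^+ 2.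
have -> : W * (W * U) - W * (Num.conj c * c) - (c * (W * Num.conj c) - c * (Num.conj c * W))
  = W * (U * W - c * Num.conj c) by ring.
by rewrite pmulr_rge0 // subr_ge0.
Qed.

Definition rank_one v w : H -> H := fun u => inner u w *: v.

Lemma rank_one_linear v w : linear (rank_one v w).
Proof. by move=> a x y; rewrite /rank_one innerDl innerZl scalerDl scalerA. Qed.

Lemma rank_one_finite_rank v w : finite_rank_operators (rank_one v w).
Proof.
split; first split; first exact: rank_one_linear.
  exists (`|w| * `|v|) => x; rewrite normrZ mulrAC ler_wpM2r//.
  by rewrite mulrC cauchy_schwarz.
exists 1, (fun=> v) => x; exists (fun=> inner x w).
by rewrite big_ord1.
Qed.

Lemma dim_ge2_orthogonal y : dim_ge H 2 -> exists2 w, w != 0 & inner y w = 0.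
Proof.
move=> [e free_e].
have [y0|y0] := eqVneq (inner y (e ord0)) 0.
  exists (e ord0) => //; apply/eqP => e0.
  have := free_e (fun i => (i == ord0)%:R).
  rewrite big_ord_recl big_ord1 /= e0 scaler0 scale0r addr0 => /(_ erefl ord0)/eqP.
  by rewrite eqxx oner_eq0.
(* The coefficients are chosen so that the two terms of [<y, w>] cancel; the conjugates undo
   conjugate-linearity in the second slot. The last coefficient is nonzero, so freeness gives
   [w != 0]. *)
pose c (i : 'I_2) := if i == ord0 then inner y (e ord_max) else - inner y (e ord0).
exists (\sum_(i < 2) Num.conj (c i) *: e i).
  apply/eqP => /free_e/(_ ord_max)/eqP.
  by rewrite /c /= fmorph_eq0 oppr_eq0 (negPf y0).
rewrite big_ord_recl big_ord1 innerDr !innerZr !conjCK /c /=.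
have -> : lift ord0 ord0 = ord_max :> 'I_2 by exact: val_inj.
by rewrite mulNr mulrC subrr.
Qed.


(* No appeal to the Riesz theorem: if [inner (T _) y] were not represented by a
   vector, then for [w] orthogonal to [y] and [S x := <T x, y> y + x] neither
   [inner (S _) y] nor [inner (S _) (y + w)] would be, so [adjoint S] would take
   its default value 0 at [y] and [y + w] although [adjoint S w = w]. But
   [adjoint S] belongs to [A], hence is additive. *)
Lemma adjoint_innerE A : dim_ge H 2 -> standard_operator_algebra A ->
  unital A -> adjoint_closed A ->
  forall T, A T -> forall x y, inner (T x) y = inner x (adjoint T y).
Proof.
move=> hdim [Abnd Alin Acomp Afin] A1 Astar T AT x y.
have [[z ez]|no_z] := pselect (exists z, forall x, inner (T x) y = inner x z).
  by rewrite (adjointE ez).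
exfalso.
have y0 : y != 0.
  by apply: contra_notN no_z => /eqP ->; exists 0 => u; rewrite !inner0r.
have y2 : inner y y != 0 by rewrite inner_eq0.
have y2r : Num.conj (inner y y) = inner y y by rewrite [RHS]innerC.
have [w w0 yw0] := dim_ge2_orthogonal y hdim.
pose S := 1 *: (rank_one y y \o T) + idfun.
have AS : A S by apply/Alin/A1/Acomp => //; apply/Afin/rank_one_finite_rank.
have SE u z : inner (S u) z = inner (T u) y * inner y z + inner u z.
  by rewrite /S /= scale1r innerDl innerZl.
have Sw : adjoint S w = w.
  by apply: adjointE => u; rewrite SE yw0 mulr0 add0r.
have Sy z : inner y z = inner y y -> adjoint S z = 0.
  move=> yz; apply: xgetPN => v /= Sz; apply: no_z.
  (* Solve [<T u, y> <y, y> + <u, z> = <u, v>] for [<T u, y>]; as [<y, y>] is real, its inverse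
     moves freely into the second slot. *)
  exists ((inner y y)^-1 *: (v - z)) => u.
  rewrite innerZr innerBr -Sz SE addrK yz fmorphV /=.
  by rewrite y2r mulrCA mulVf ?mulr1.
have [/(_ 1 y w) + _] := Abnd _ (Astar _ AS).
rewrite !scale1r Sw !Sy ?innerDr ?yw0 ?addr0// add0r => /esym/eqP.
exact/negP.
Qed.

End rank_one_and_adjoint.

Theorem theorem2p4 (R : realType) (H : hilbertType R) (hdim : dim_ge H 2)
    (A : set (H -> H)) (hA : standard_operator_algebra A) (hA1 : unital A)
    (hAstar : adjoint_closed A)
    (phi : {fun A >-> A}) (hphi : linear_on A phi) :
  left_centralizer A phi <->
  (forall S T : H -> H, A S -> A T ->
     S \o adjoint T = 0 -> S \o adjoint (phi T) = 0).
Proof.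
have adjP := adjoint_innerE hdim hA hA1 hAstar.
have Aphi T : A T -> A (phi T) by exact: funS.
case: hA => Abnd Alin Acomp Afin.
have Ar1 v w : A (rank_one v w) by apply/Afin/rank_one_finite_rank.
have A0 T : A T -> T 0 = 0.
  by move=> /Abnd[/(_ (-1) 0 0) + _]; rewrite scaler0 addr0 scaleN1r addNr.
have AB T a b x y : A T -> T (a *: x - b *: y) = a *: T x - b *: T y.
  move=> AT; have [linT _] := Abnd T AT.
  by rewrite linT -scaleNr -[_ *: y]addr0 linT A0// addr0 scaleNr.
split=> [phiM S T AS AT ST0|ker_phi].
  apply/funext => y /=.
  rewrite (@adjointE _ _ (phi T) y (adjoint T (adjoint (phi idfun) y))).
    exact: (congr1 (fun f => f _) ST0).
  move=> x; rewrite (phiM idfun T hA1 AT : phi T = _) /= !adjP//.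
  exact: Aphi.
have {}ker_phi T x : A T -> T x = 0 -> phi T x = 0.
  move=> AT Tx0.
  have /ker_phi-/(_ (Ar1 x x) AT) : rank_one x x \o adjoint T = 0.
    by apply/funext => u; rewrite /= /rank_one innerC -adjP// Tx0 inner0l rmorph0 scale0r.
  (* At the vector [phi T x] the identity reads [<phi T x, phi T x> x = 0] up to conjugation, so
     [phi T x = 0] or [x = 0]. *)
  move=> /(congr1 (fun f => f (phi T x)))/eqP.
  rewrite /= /rank_one scaler_eq0 innerC -adjP; last exact: Aphi.
  rewrite fmorph_eq0 inner_eq0 => /orP[/eqP//|/eqP ->].
  exact/A0/Aphi.
have phi_eq S T x a : A S -> A T -> T x = a *: S x -> phi T x = a *: phi S x.
  (* The operator [- a S + T] lies in [A] and kills [x], so [ker_phi] applies to it. *)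
  move=> AS AT eTS; apply/eqP; rewrite -subr_eq0 addrC -scaleNr; apply/eqP.
  rewrite -[LHS]/((- a *: phi S + phi T) x) -hphi//; apply: ker_phi.
    exact: Alin.
  by rewrite -[LHS]/(- a *: S x + T x) eTS -scalerDl addNr scale0r.
suff phi1 T x : A T -> phi T x = phi idfun (T x).
  move=> S T AS AT; apply/funext => x /=.
  by rewrite (phi1 _ _ AS) (phi1 (S \o T))//; apply: Acomp.
move=> AT; set v := T x.
have [v0|v0] := eqVneq v 0; first by rewrite v0 !ker_phi.
have x0 : x != 0.
  by apply: contra_neq v0 => x0; rewrite /v x0 A0.
have [w xw vw] : exists2 w, inner x w != 0 & inner v w != 0.
  (* Take [w = x] unless [v] is orthogonal to [x]; then [w = x + v] pairs with [x] to [<x, x>] and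
     with [v] to [<v, v>]. *)
  have [vx|vx] := eqVneq (inner v x) 0; last by exists x; rewrite ?inner_eq0.
  exists (x + v).
    by rewrite innerDr (innerC x v) vx rmorph0 addr0 inner_eq0.
  by rewrite innerDr vx add0r inner_eq0.
pose F := rank_one v w.
have Fv : phi F v = inner v w *: phi idfun v by exact: phi_eq hA1 (Ar1 v w) _.
have Fx : phi F x = inner x w *: phi T x by exact: phi_eq AT (Ar1 v w) _.
have : phi F (inner v w *: x - inner x w *: v) = 0.
  apply: ker_phi; first exact: Ar1.
  rewrite AB; last exact: Ar1.
  by rewrite /F /rank_one !scalerA mulrC subrr.
rewrite AB; last exact/Aphi/Ar1.
(* Both terms now carry the same nonzero scalar [<x, w> <v, w>], which cancels. *)
rewrite Fx Fv !scalerA mulrC => /eqP; rewrite subr_eq0 => /eqP.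
by apply: scalerI; rewrite mulf_neq0.
Qed.
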